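(* Let $\Omega$ be an infinite set and let $\mathcal{F}$ be an ultrafilter on $\Omega$. Then the stabiliser $\operatorname{Sym}(\Omega)_{\{\mathcal{F}\}}$ of $\mathcal{F}$ is a maximal subsemigroup of $\operatorname{Sym}(\Omega)$.
   Context: $\operatorname{Sym}(\Omega)$ is the symmetric group on $\Omega$. The stabiliser of $\mathcal{F}$ is $\operatorname{Sym}(\Omega)_{\{\mathcal{F}\}}=\{f\in\operatorname{Sym}(\Omega):(\forall\Sigma\subseteq\Omega)(\Sigma\in\mathcal{F}\leftrightarrow\Sigma f\in\mathcal{F})\}$, where $\Sigma f$ is the image of $\Sigma$ under $f$. A subsemigroup $T$ of a semigroup (or group) $S$ is a maximal subsemigroup if $T\neq S$ and the subsemigroup generated by $T$ and $s$ equals $S$ for all $s\in S\setminus T$ (generation is as a semigroup, without taking inverses). *)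

(* Defs.v *)
From HB Require Import structures.
From mathcomp Require Import all_boot.
From mathcomp Require Import boolp classical_sets functions cardinality filter.

Set Implicit Arguments.
Unset Strict Implicit.
Unset Printing Implicit Defensive.

Local Open Scope classical_set_scope.
Local Open Scope group_scope.

Record Sym (Omega : Type) := MkSym {
  sym_fun :> Omega -> Omega;
  sym_bij : bijective sym_fun
}.

Section SymGroup.
Variable Omega : Type.
Implicit Types f g h : Sym Omega.

Lemma sym_ext f g : f =1 g -> f = g.
Proof.
case: f g => [f fb] [g gb] /= /funext fg; subst g.
by congr MkSym; exact: Prop_irrelevance.
Qed.

HB.instance Definition _ := gen_eqMixin (Sym Omega).
HB.instance Definition _ := gen_choiceMixin (Sym Omega).

Lemma sym_one_subproof : bijective (@id Omega).
Proof. by exists id. Qed.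

Definition sym_one : Sym Omega := MkSym sym_one_subproof.

(* Permutations act on the right: x (f g) = (x f) g. *)
Definition sym_mul f g : Sym Omega := MkSym (bij_comp (sym_bij g) (sym_bij f)).

Lemma sym_inv_subproof f : exists g : Sym Omega, cancel f g /\ cancel g f.
Proof.
case: (sym_bij f) => g fK gK.
by exists (MkSym (Bijective gK fK)).
Qed.

Definition sym_inv f : Sym Omega := projT1 (cid (sym_inv_subproof f)).

Lemma sym_funK f : cancel f (sym_inv f).
Proof. by rewrite /sym_inv; case: cid => g []. Qed.

Lemma sym_invK f : cancel (sym_inv f) f.
Proof. by rewrite /sym_inv; case: cid => g []. Qed.

Lemma sym_mulA : associative sym_mul.
Proof. by move=> f g h; exact: sym_ext. Qed.

Lemma sym_mul1 : left_id sym_one sym_mul.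
Proof. by move=> f; exact: sym_ext. Qed.

Lemma sym_mulr1 : right_id sym_one sym_mul.
Proof. by move=> f; exact: sym_ext. Qed.

Lemma sym_mulV : left_inverse sym_one sym_inv sym_mul.
Proof. by move=> f; apply: sym_ext => x; exact: sym_invK. Qed.

Lemma sym_mulrV : right_inverse sym_one sym_inv sym_mul.
Proof. by move=> f; apply: sym_ext => x; exact: sym_funK. Qed.

HB.instance Definition _ := isGroup.Build (Sym Omega)
  sym_mulA sym_mul1 sym_mulr1 sym_mulV sym_mulrV.

Lemma symM f g x : (f * g) x = g (f x). Proof. by []. Qed.

End SymGroup.

Definition family_stabiliser (Omega : Type) (F : set_system Omega) :
    set (Sym Omega) :=
  [set f : Sym Omega | forall Sigma : set Omega, F Sigma <-> F (f @` Sigma)].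

Definition subsemigroup (S : semigroupType) (T : set S) : Prop :=
  T !=set0 /\ forall x y, T x -> T y -> T (x * y).

Definition semigroup_gen (S : semigroupType) (A : set S) : set S :=
  smallest (@subsemigroup S) A.

Definition maximal_subsemigroup (S : semigroupType) (T : set S) : Prop :=
  [/\ subsemigroup T,
      T <> [set: S] &
      forall s, ~ T s -> semigroup_gen (T `|` [set s]) = [set: S]].

(* Main.v *)
Require Import Defs.
From mathcomp Require Import all_boot.
From mathcomp Require Import boolp classical_sets functions cardinality filter.

(** Write G for the stabiliser of the ultrafilter F.  A permutation lies in G
    as soon as it fixes every point of some member of F
    ([pointwise_stabiliser_sub]).  This supplies enough elements of G to show
    that any two permutations s and h outside G satisfy h = g1 s g2 with g1
    and g2 in G ([stabiliser_double_coset]); so a subsemigroup containing G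
    and one such s contains everything.

    For the double coset statement, if h s^-1 is in G there is nothing to do.
    Otherwise each of s, h and h s^-1 carries some member of F out of F.
    Intersecting these three members, and removing the image of the third
    under h s^-1, leaves a member A of F such that A s and A h are disjoint
    and neither is in F.  The involution g2 that exchanges a s with
    a h for every a in A fixes the complement of the union of A s and A h,
    which is in F, so g2 is in G; and h g2^-1 s^-1 fixes A pointwise, so it is
    in G too.  The disjointness of A s and A h is what lets the partial
    bijection between them be completed by its inverse and the identity,
    instead of by a bijection between their complements.

    That G is not everything also comes from an involution
    ([stabiliser_proper]).  By Zorn's lemma there is a maximal family of
    disjoint ordered pairs of points; it misses at most one point.  F contains
    the set of first coordinates, or the set of second coordinates, or the set
    of missed points.  In the first two cases the involution exchanging the
    coordinates moves a member of F to a disjoint set; in the last, F contains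
    a singleton, and a transposition moves its point. *)

Set Implicit Arguments.
Unset Strict Implicit.

Local Open Scope classical_set_scope.
Local Open Scope group_scope.

(** * Involutions attached to families of disjoint pairs *)

Section Matching.
Variable T : Type.
Implicit Types (R : set (T * T)) (x y z : T).

(** Pairwise disjoint ordered pairs, none of them on the diagonal: the case
    p = q of the first clause excludes the diagonal. *)
Definition matching R := forall p q, R p -> R q ->
  p.1 <> q.2 /\ (p.1 = q.1 <-> p.2 = q.2).

Definition adjacent R x y := R (x, y) \/ R (y, x).

Definition swap R x : T := @xget {classic T} x [set y | adjacent R x y].

Lemma adjacent_sym R x y : adjacent R x y -> adjacent R y x.
Proof. by case; [right | left]. Qed.

Lemma adjacent_inj R x y z :
  matching R -> adjacent R x y -> adjacent R x z -> y = z.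
Proof.
move=> mR [] Ry [] Rz; have [/= ne eq] := mR _ _ Ry Rz.
- exact/eq.
- by [].
- by have [/= ne' _] := mR _ _ Rz Ry.
- exact/eq.
Qed.

Lemma swapE R x y : matching R -> adjacent R x y -> swap R x = y.
Proof.
move=> mR xy; apply: (@xget_subset1 {classic T}) => // u v.
exact: adjacent_inj.
Qed.

Lemma swap_fixed R x : ~ (exists y, adjacent R x y) -> swap R x = x.
Proof.
by move=> nx; apply: (@xgetPN {classic T}) => y xy; apply: nx; exists y.
Qed.

Lemma swapK R : matching R -> involutive (swap R).
Proof.
move=> mR x; case: (pselect (exists y, adjacent R x y)) => [[y xy]|nx].
  by rewrite (swapE mR xy); exact: swapE (adjacent_sym xy).
by rewrite (swap_fixed nx) swap_fixed.
Qed.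

Definition swap_perm R (mR : matching R) : Sym T :=
  MkSym (inv_bij (swapK mR)).

Lemma matching_pair x y : x <> y -> matching [set (x, y)].
Proof. by move=> xy _ _ -> ->. Qed.

Lemma matching_bigcup (C : set (set (T * T))) :
  C `<=` [set R | matching R] -> total_on C subset ->
  matching (\bigcup_(R in C) R).
Proof.
move=> mC totC p q [R CR Rp] [S CS Sq].
have [RS|SR] := totC _ _ CR CS.
- exact: (mC _ CS) (RS _ Rp) Sq.
- exact: (mC _ CR) Rp (SR _ Sq).
Qed.

(** In a maximal matching, two uncovered points would form a pair that could
    be added. *)
Lemma exists_matching_missing_le1 :
  exists2 R, matching R & is_subset1 [set x | ~ exists y, adjacent R x y].
Proof.
have [R [mR maxR]] := @Zorn_bigcup _ [set R | matching R] matching_bigcup.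
exists R => // x y /= nx ny; apply: contrapT => xy.
apply: (maxR (R `|` [set (x, y)])).
  split=> [|RE]; first exact: subsetUl.
  by apply: nx; exists y; left; apply: RE; right.
have R_nx u v : R (u, v) -> [/\ u <> x, u <> y, v <> x & v <> y].
  move=> Ruv; split=> uv; subst.
  - by apply: nx; exists v; left.
  - by apply: ny; exists v; left.
  - by apply: nx; exists u; right.
  - by apply: ny; exists u; right.
move=> [u v] [u' v'] [Rp|[-> ->]] [Rq|[-> ->]] /=.
- exact: mR Rp Rq.
- by case: (R_nx _ _ Rp).
- by case: (R_nx _ _ Rq) => ? ? ? ?; split=> [/esym|] //; split=> /esym.
- by [].
Qed.

End Matching.

(** * The stabiliser of an ultrafilter *)

Section Stabiliser.
Variables (Omega : Type) (F : set_system Omega).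
Hypothesis ultraF : UltraFilter F.
Implicit Types (f g h s : Sym Omega) (A B : set Omega).

Local Notation G := (family_stabiliser F).

Lemma ultra_disjoint A B : F A -> F B -> A `&` B = set0 -> False.
Proof.
move=> FA FB AB0; have : F (A `&` B) by exact: filterI.
by rewrite AB0; exact: filter_not_empty.
Qed.

(** Invariance needs checking in one direction only: if A is not in F then its
    complement is, and the disjoint images of the two cannot both be in F. *)
Lemma stabiliserP f : (forall A, F A -> F (f @` A)) -> G f.
Proof.
move=> fF A; split; first exact: fF.
move=> FfA; have [//|/fF FfCA] := in_ultra_setVsetC A ultraF.
case: (ultra_disjoint FfA FfCA).
apply/seteqP; split=> // _ [[x Ax <-] [y nAy /(bij_inj (sym_bij f)) yx]].
by rewrite yx in nAy.
Qed.

Lemma not_stabiliserP f : ~ G f -> exists2 A, F A & ~ F (f @` A).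
Proof.
move=> nGf; apply: contrapT => noA; apply/nGf/stabiliserP => A FA.
by apply: contrapT => nFfA; apply: noA; exists A.
Qed.

Lemma pointwise_stabiliser_sub f A : F A -> {in A, forall x, f x = x} -> G f.
Proof.
move=> FA fA; apply: stabiliserP => B FB.
apply: filterS (filterI FA FB) => x [Ax Bx].
by exists x => //; apply: fA; rewrite inE.
Qed.

Lemma not_stabiliser_disjoint f A : F A -> A `&` f @` A = set0 -> ~ G f.
Proof. by move=> FA fA0 /(_ A) [/(_ FA) FfA _]; exact: ultra_disjoint fA0. Qed.

Lemma stabiliser1 : G 1.
Proof. by apply: stabiliserP => A FA; rewrite image_id. Qed.

Lemma subsemigroup_stabiliser : subsemigroup G.
Proof.
split; first by exists 1; exact: stabiliser1.
move=> f g Gf Gg; apply: stabiliserP => A /(Gf A) /(Gg _).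
by rewrite image_comp.
Qed.

(** The elements outside the stabiliser form a single double coset: g2 moves
    the image ultrafilter of F under s to the one under h, after which h and
    s g2 differ by an element of the stabiliser. *)
Lemma stabiliser_double_coset s h : ~ G s -> ~ G h ->
  exists g1 g2, [/\ G g1, G g2 & h = g1 * s * g2].
Proof.
move=> nGs nGh; case: (pselect (G (h * s^-1))) => [Ghs|nGhs].
  by exists (h * s^-1), 1; split; [|exact: stabiliser1|rewrite mulg1 mulgVK].
have [As FAs nFs] := not_stabiliserP nGs.
have [Ah FAh nFh] := not_stabiliserP nGh.
have [Ahs FAhs nFhs] := not_stabiliserP nGhs.
have FC B : ~ F B -> F (~` B) by case: (in_ultra_setVsetC B ultraF).
pose A := As `&` Ah `&` (Ahs `&` ~` ((h * s^-1) @` Ahs)).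
have FA : F A.
  by do !apply: filterI => //; exact: FC.
have sK : cancel s (s^-1)%g := sym_funK s.
have s_inj : injective s := bij_inj (sym_bij s).
have h_inj : injective h := bij_inj (sym_bij h).
pose R := [set (s a, h a) | a in A].
have mR : matching R.
  move=> _ _ [a Aa <-] [b Ab <-] /=; split; last first.
    by split=> [/s_inj|/h_inj] ->.
  (* s a = h b would make a the image of b under h s^-1 *)
  move=> ab; case: Aa => _ [_]; apply; exists b; first by case: Ab => _ [].
  by rewrite symM -ab sK.
pose g2 := swap_perm mR.
have g2K : cancel g2 g2 := swapK mR.
have g2E a : A a -> g2 (h a) = s a.
  by move=> Aa; apply: swapE => //; right; exists a.
exists (h * g2^-1 * s^-1), g2; split; last by rewrite mulgVK mulgVK.
- apply: pointwise_stabiliser_sub FA _ => a; rewrite inE => Aa.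
  by rewrite !symM -(g2K (h a)) g2E // (sym_funK g2) sK.
- apply: pointwise_stabiliser_sub (filterI (FC _ nFs) (FC _ nFh)) _ => x.
  rewrite inE => -[nsx nhx].
  apply: swap_fixed => -[y [] [a [[Asa Aha] _] [ax ay]]].
  + by apply: nsx; exists a.
  + by apply: nhx; exists a.
Qed.

(** A maximal matching stands in for the splitting of an infinite set into two
    equipotent halves. *)
Lemma stabiliser_proper : infinite_set [set: Omega] -> G <> [set: Sym Omega].
Proof.
move=> infO GT; have inG f : G f by rewrite GT.
have [R mR missR] := exists_matching_missing_le1 Omega.
pose r := swap_perm mR.
have nFfst : ~ F [set p.1 | p in R].
  move=> FR; apply: (not_stabiliser_disjoint (f := r) FR) (inG _).
  apply/seteqP; split=> // _ [[[x y] Rp <-] [_ [[u v] Rq <-]]] /=.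
  rewrite (swapE mR (or_introl Rq)) => vx.
  by have [/(_ (esym vx))] := mR _ _ Rp Rq.
have nFsnd : ~ F [set p.2 | p in R].
  move=> FR; apply: (not_stabiliser_disjoint (f := r) FR) (inG _).
  apply/seteqP; split=> // _ [[[x y] Rp <-] [_ [[u v] Rq <-]]] /=.
  rewrite (swapE mR (or_intror Rq)) => uy.
  by have [/(_ uy)] := mR _ _ Rq Rp.
have FC B : ~ F B -> F (~` B) by case: (in_ultra_setVsetC B ultraF).
have Fmiss : F [set x | ~ exists y, adjacent R x y].
  apply: filterS (filterI (FC _ nFfst) (FC _ nFsnd)) => x [n1 n2] [y []] Rp.
  + by apply: n1; exists (x, y).
  + by apply: n2; exists (y, x).
(* the set of missed points is a singleton, so F is principal *)
have [p missp] := filter_ex Fmiss.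
have Fp : F [set p] by apply: filterS Fmiss => x missx; exact: missR.
have [q qp] : exists q, q <> p.
  apply: contrapT => noq; apply: infO; apply: sub_finite_set (finite_set1 p).
  by move=> q _; apply: contrapT => qp; apply: noq; exists q.
have mt := matching_pair qp.
apply: (not_stabiliser_disjoint (f := swap_perm mt) Fp) (inG _).
apply/seteqP; split=> // x [/= -> [_ -> ]].
by rewrite (swapE (y := q) mt); [|right].
Qed.

End Stabiliser.

Theorem theorem10p6 (Omega : Type) (F : set_system Omega) :
  infinite_set [set: Omega] -> UltraFilter F ->
  maximal_subsemigroup (family_stabiliser F).
Proof.
move=> infO ultraF; split.
- exact: subsemigroup_stabiliser.
- exact: stabiliser_proper.
move=> s nGs; apply/seteqP; split=> // h _ C [[_ mulC] subC].
have GC g : family_stabiliser F g -> C g by move=> Gg; apply: subC; left.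
case: (pselect (family_stabiliser F h)) => [/GC//|nGh].
have [g1 [g2 [Gg1 Gg2 ->]]] := stabiliser_double_coset ultraF nGs nGh.
have Cs : C s by apply: subC; right.
exact: mulC (mulC _ _ (GC _ Gg1) Cs) (GC _ Gg2).
Qed.
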